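(* Let $D$ be a division ring that is not the field of two elements and let $n$ be a positive integer. If a matrix $N\in\mathrm{M}_n(D)$ is nilpotent, then $N$ can be expressed as a product of two diagonalizable matrices in $\mathrm{M}_n(D)$. Moreover, the number $2$ is sharp: it cannot in general be replaced by $1$, i.e. there exist such a $D$, a positive integer $n$, and a nilpotent matrix in $\mathrm{M}_n(D)$ that is not diagonalizable.
   Context: $\mathrm{M}_n(D)$ is the ring of $n\times n$ matrices over $D$. A square matrix over $D$ is diagonalizable if it is similar over $D$ (conjugate by an invertible matrix over $D$) to a diagonal matrix with entries in $D$. Division rings may be commutative or noncommutative. *)

(* Defs.v *)
From HB Require Import structures.
From mathcomp Require Import all_boot all_order all_algebra.
Set Implicit Arguments.
Unset Strict Implicit.
Unset Printing Implicit Defensive.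
Import GRing.Theory.
Local Open Scope ring_scope.

(* [GRing.field_axiom] says that every nonzero element is a unit; it does not
   assume commutativity, and a [unitRingType] is nontrivial with two-sided
   inverses. *)
Definition division_ring (D : unitRingType) : Prop := GRing.field_axiom D.

Definition is_field_of_two (D : unitRingType) : Prop :=
  exists f : {rmorphism D -> 'F_2}, bijective f.

Definition nilpotent_mx (D : unitRingType) (n : nat) (N : 'M[D]_n) : Prop :=
  exists k : nat, N ^+ k = 0.

(* [unitmx] and the similarity and diagonalizability notions of the library
   require commutative coefficients, so inverses are given explicitly. *)
Definition similar_mx (D : unitRingType) (n : nat) (A B : 'M[D]_n) : Prop :=
  exists P Q : 'M[D]_n,
    [/\ P *m Q = 1%:M, Q *m P = 1%:M & A = P *m B *m Q].

Definition diagonalizable_mx (D : unitRingType) (n : nat) (A : 'M[D]_n) : Prop :=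
  exists2 B : 'M[D]_n, is_diag_mx B & similar_mx A B.

(* Main.v *)
(* A nilpotent matrix is a direct sum of Jordan blocks, so one block suffices.
   Fix c different from 0 and 1. The block is a product of two matrices A and B
   made of 1x1 blocks and of 2x2 blocks [[1+c, -c], [1, 0]], which are similar
   to diag(1, c): A pairs the indices x <-> n-1-x and B the indices
   x <-> n-2-x, with a zero at n-1. As x -> n-2-x -> x+1, the product A B is
   strictly lower triangular with nonzero subdiagonal entries, hence similar to
   the block. *)
Require Import Defs.
From Stdlib Require Classical_Prop.
From HB Require Import structures.
From mathcomp Require Import all_boot all_order all_algebra.
From mathcomp Require Import zify.
Set Implicit Arguments.
Unset Strict Implicit.
Import GRing.Theory.
Local Open Scope ring_scope.

(** * Matrices attached to an involution of the indices *)

Lemma sum_mulr_eq (R : pzRingType) (n : nat) (f : 'I_n -> R) (x : R) (j : 'I_n) :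
  \sum_k f k * (x *+ (k == j)) = f j * x.
Proof.
rewrite (bigD1 j) //= eqxx mulr1n big1 ?addr0 // => k /negbTE ->.
by rewrite mulr0n mulr0.
Qed.

(** For an involution [s] this is block diagonal up to a permutation of the indices, with 1x1 blocks
    at the fixed points and 2x2 blocks on the 2-cycles. The coefficients are indexed by column. *)
Definition pair_mx (R : pzRingType) (n : nat) (s : 'I_n -> 'I_n)
    (a b : 'I_n -> R) : 'M[R]_n :=
  \matrix_(i, j) (a j *+ (i == j) + b j *+ (i == s j)).

Lemma pair_mxM (R : pzRingType) (n : nat) (s t : 'I_n -> 'I_n)
    (a b a' b' : 'I_n -> R) (i j : 'I_n) :
  (pair_mx s a b *m pair_mx t a' b') i j =
    (a j * a' j) *+ (i == j) + (b j * a' j) *+ (i == s j)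
    + ((a (t j) * b' j) *+ (i == t j) + (b (t j) * b' j) *+ (i == s (t j))).
Proof.
rewrite mxE; under eq_bigr => k _ do rewrite [X in _ * X]mxE mulrDr.
by rewrite big_split /= !sum_mulr_eq !mxE !mulrDl !mulrnAl.
Qed.

Lemma pair_mxM_same (R : pzRingType) (n : nat) (s : 'I_n -> 'I_n)
    (a b a' b' : 'I_n -> R) : involutive s ->
  pair_mx s a b *m pair_mx s a' b' =
  pair_mx s (fun j => a j * a' j + b (s j) * b' j)
            (fun j => b j * a' j + a (s j) * b' j).
Proof.
move=> sK; apply/matrixP => i j; rewrite pair_mxM sK [RHS]mxE !mulrnDl.
by rewrite -!addrA; congr (_ + _); rewrite addrCA addrC -!addrA [in RHS]addrCA.
Qed.

Lemma eq_pair_mx (R : pzRingType) (n : nat) (s : 'I_n -> 'I_n)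
    (a b a' b' : 'I_n -> R) : a =1 a' -> b =1 b' ->
  pair_mx s a b = pair_mx s a' b'.
Proof. by move=> ea eb; apply/matrixP => i j; rewrite !mxE ea eb. Qed.

Lemma pair_mx_diag (R : pzRingType) (n : nat) (s : 'I_n -> 'I_n)
    (a : 'I_n -> R) : is_diag_mx (pair_mx s a (fun=> 0)).
Proof.
apply/is_diag_mxP => i j nij; rewrite mxE mul0rn addr0.
by have [e|_] := eqVneq i j; [rewrite e eqxx in nij | rewrite mulr0n].
Qed.

Lemma pair_mx1 (R : pzRingType) (n : nat) (s : 'I_n -> 'I_n) :
  pair_mx s (fun=> 1) (fun=> 0) = 1%:M :> 'M[R]_n.
Proof. by apply/matrixP => i j; rewrite !mxE mul0rn addr0. Qed.

(* On each 2-cycle [{x, s x}] of [s] the matrix is [[1+c, -c], [1, 0]], with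
   eigenvalues 1 and c; the fixed points of [s] are eigenvectors. *)
Lemma pair_mx_diagonalizable (D : unitRingType) (c : D) (n : nat)
    (s : 'I_n -> 'I_n) (u : pred 'I_n) (d : 'I_n -> D) :
  1 - c \is a GRing.unit -> involutive s ->
  (forall j, s j != j -> u (s j) = ~~ u j) ->
  diagonalizable_mx
    (pair_mx s (fun j => if s j == j then d j else if u j then 1 + c else 0)
               (fun j => if s j == j then 0 else if u j then 1 else - c)).
Proof.
move=> Uc sK us; pose e := (1 - c)^-1.
have ec : e * c = c * e.
  by apply/esym/commrV; apply: commrB; [apply: commr1 | apply: commr_refl].
have e1 : e - e * c = 1 by rewrite -{1}[e]mulr1 -mulrBr mulVr.
have fs j : (s (s j) == s j) = (s j == j) by rewrite sK eq_sym.
(* The columns of [V] are eigenvectors: on a 2-cycle, (1, 1) for the eigenvalue 1 and (c, 1) for c.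
   [W] is the usual 2x2 inverse, with [e] inverting the determinant 1 - c; it is valid because [e]
   commutes with [c]. *)
pose V := pair_mx s (fun=> 1) (fun j => if s j == j then 0 else if u j then 1 else c).
pose W := pair_mx s (fun j => if s j == j then 1 else e)
            (fun j => if s j == j then 0 else if u j then - e else - (e * c)).
pose B := pair_mx s (fun j => if s j == j then d j else if u j then 1 else c) (fun=> 0).
have VW : V *m W = 1%:M.
  rewrite /V /W pair_mxM_same // -(@pair_mx1 _ _ s).
  apply: eq_pair_mx => j; rewrite /= ?fs; case: (eqVneq (s j) j) => sj;
    rewrite ?us //=; try case: (u j) => /=;
    by rewrite ?mul1r ?mulr0 ?mul0r ?addr0 ?mulrN ?mul1r -?ec ?e1 ?subrr ?mulrN.
have WV : W *m V = 1%:M.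
  rewrite /V /W pair_mxM_same // -(@pair_mx1 _ _ s).
  apply: eq_pair_mx => j; rewrite /= ?fs; case: (eqVneq (s j) j) => sj;
    rewrite ?us //=; try case: (u j) => /=;
    by rewrite ?mul1r ?mulr1 ?mulr0 ?mul0r ?addr0 ?mulNr ?e1 ?addNr.
exists B; first exact: pair_mx_diag.
exists V, W; split=> //.
set G := pair_mx _ _ _.
suff GV : G *m V = V *m B by rewrite -GV -mulmxA VW mulmx1.
rewrite /G /V /B !pair_mxM_same //.
apply: eq_pair_mx => j; rewrite /= ?fs; case: (eqVneq (s j) j) => sj;
    rewrite ?us //=; try case: (u j) => /=;
    rewrite ?mul1r ?mulr1 ?mulr0 ?mul0r ?addr0 ?add0r //.
- by rewrite addrK.
- by rewrite mulrDl mul1r addKr.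
Qed.

(** * Nilpotency index and Jordan chains *)

(** An entry on the [t]-th subdiagonal of the power is a product of [t] subdiagonal entries of [M],
    hence nonzero. For [t] equal to [n] and to [n.-1] this shows that [M] is nilpotent of maximal
    index. *)
Lemma subdiag_expr (D : unitRingType) (n : nat) (M : 'M[D]_n) :
  division_ring D ->
  (forall i j : 'I_n, (i < j.+1)%N -> M i j = 0) ->
  (forall i j : 'I_n, i = j.+1 :> nat -> M i j != 0) ->
  forall t, (forall i j : 'I_n, (i < j + t)%N -> (M ^+ t) i j = 0) /\
            (forall i j : 'I_n, i = (j + t)%N :> nat -> (M ^+ t) i j != 0).
Proof.
move=> hD M0 M1; elim=> [|t [IH0 IH1]].
  rewrite expr0; split=> i j; rewrite addn0 => hij; rewrite !mxE.
    by rewrite -val_eqE ltn_eqF.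
  by rewrite -val_eqE /= hij eqxx oner_eq0.
rewrite exprS; split=> i j hij; rewrite mxE.
  apply: big1 => k _; case: (ltnP k (j + t)) => hk.
    by rewrite IH0 ?mulr0.
  by rewrite M0 ?mul0r //; lia.
have hk : (j + t < n)%N by move: (ltn_ord i); lia.
(* Only the index [j + t] contributes: smaller ones are killed by the power, larger ones by [M]. *)
rewrite (bigD1 (Ordinal hk)) //= big1 => [|k nk].
  have U1 : M i (Ordinal hk) \is a GRing.unit by apply: hD; apply: M1 => /=; lia.
  have U2 : (M ^+ t) (Ordinal hk) j \is a GRing.unit by apply: hD; apply: IH1.
  by rewrite addr0; apply: contraNneq (oner_neq0 D) => E;
     rewrite -(mulVr U2) -[X in _ * X]mul1r -(mulVr U1) -mulrA E !mulr0.
have {}nk : (k != j + t :> nat)%N by [].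
case: (ltnP k (j + t)) => hk'; first by rewrite IH0 ?mulr0.
by rewrite M0 ?mul0r //; lia.
Qed.

(** The nilpotent Jordan block, lower triangular to match the order v, N v, N^2 v, ... of a
    chain. *)
Definition jordan0 (R : pzRingType) (k : nat) : 'M[R]_k :=
  \matrix_(i, j) (i == j.+1 :> nat)%:R.

(* Subtracting from [phi] multiples of the [phi *m N ^+ s] kills the values
   [phi N^l v] one by one, downwards from [l = k - 1]. *)
Lemma dual_functional (R : pzRingType) (n k : nat) (N : 'M[R]_n)
    (phi : 'rV[R]_n) (v : 'cV[R]_n) :
  N ^+ k.+1 = 0 -> phi *m N ^+ k *m v = 1%:M ->
  exists psi : 'rV[R]_n,
    forall l, psi *m N ^+ l *m v = (l == k)%:R%:M.
Proof.
move=> Nk phiv.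
have big l : (k < l)%N -> N ^+ l = 0.
  by move=> kl; rewrite -(subnK kl) exprD Nk mulr0.
suff: forall s, (s <= k)%N -> exists2 psi : 'rV[R]_n, psi *m N ^+ k *m v = 1%:M &
    forall l, (k - s <= l < k)%N -> psi *m N ^+ l *m v = 0.
  move=> /(_ k (leqnn k))[psi psik psiv]; exists psi => l.
  case: ltngtP => lk; rewrite /= ?raddf0.
  - by apply: psiv; lia.
  - by rewrite big // mulmx0 mul0mx.
  - by rewrite lk psik.
elim=> [|s IH] sk.
  by exists phi => // l; lia.
have [psi psik psiv] := IH (ltnW sk).
(* [N ^+ s.+1] moves the value 1 from exponent [k] to [k - s.+1] and leaves the higher values
   unchanged. The 1x1 matrix [a] acts on the left, so nothing has to commute. *)
pose a := psi *m N ^+ (k - s.+1) *m v.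
have E l : (psi - a *m psi *m N ^+ s.+1) *m N ^+ l *m v =
    psi *m N ^+ l *m v - a *m (psi *m N ^+ (s.+1 + l) *m v).
  by rewrite mulmxBl mulmxBl exprD -!mulmxA.
exists (psi - a *m psi *m N ^+ s.+1) => [|l hl].
  by rewrite E psik big ?mulmx0 ?mul0mx ?mulmx0 ?subr0 //; lia.
rewrite E; have [l0|nl] := eqVneq l (k - s.+1)%N.
  by rewrite l0 subnKC // psik mulmx1 subrr.
by rewrite psiv ?big ?mulmx0 ?mul0mx ?mulmx0 ?subr0 //; lia.
Qed.

(** The columns of [C] are v, N v, ..., N^k v; the rows of [L] are psi N^k, ..., psi N, psi for a
    functional psi dual to the chain, so that entry (p, q) of [L *m C] is psi N^(k-p+q) v. As [L]
    intertwines too, its kernel is an [N]-stable complement of the chain. *)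
Lemma nilpotent_chain (D : unitRingType) (n k : nat) (N : 'M[D]_n) :
  division_ring D -> N ^+ k.+1 = 0 -> N ^+ k != 0 ->
  exists (C : 'M[D]_(n, k.+1)) (L : 'M[D]_(k.+1, n)),
    [/\ L *m C = 1%:M, N *m C = C *m jordan0 D k.+1 & L *m N = jordan0 D k.+1 *m L].
Proof.
move=> hD Nk /eqP Nk0.
have [i [j nij]] : exists i j, (N ^+ k) i j != 0.
  have [/existsP[i /existsP[j nij]]|/existsPn h] :=
    boolP [exists i, exists j, (N ^+ k) i j != 0]; first by exists i, j.
  case: Nk0; apply/matrixP => i j; rewrite mxE; apply/eqP.
  by have /existsPn/(_ j) := h i; rewrite negbK.
(* The scaling gives row [i] of [N ^+ k] the value 1 on [v]. *)
pose v : 'cV[D]_n := delta_mx j 0 *m (((N ^+ k) i j)^-1)%:M.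
have [|psi psiv] := @dual_functional D n k N (delta_mx 0 i) v Nk.
  rewrite /v -rowE mulmxA -colE; apply/matrixP => p q; rewrite !ord1 mxE.
  by rewrite big_ord1 !mxE eqxx mulr1n divrr // hD.
have exprA a b : N ^+ a *m N ^+ b = N ^+ (a + b) by rewrite exprD.
exists (\matrix_(p, q) (N ^+ q *m v) p 0), (\matrix_(p, q) (psi *m N ^+ (k - p)) 0 q).
split; apply/matrixP => p q.
- transitivity ((psi *m N ^+ (k - p) *m (N ^+ q *m v)) 0 0).
    by rewrite [RHS]mxE [LHS]mxE; apply: eq_bigr => l _; rewrite !mxE.
  rewrite mulmxA -(mulmxA psi) exprA psiv !mxE eqxx mulr1n -val_eqE.
  by congr (_ %:R); have := ltn_ord p; have := ltn_ord q; rewrite /=; lia.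
- transitivity ((N ^+ q.+1 *m v) p 0).
    by rewrite exprS -mulmxE -mulmxA [RHS]mxE [LHS]mxE; apply: eq_bigr => l _; rewrite !mxE.
  (* The last column is the end of the chain, where both sides vanish. *)
  rewrite [RHS]mxE; have [hq|hq] := ltnP q.+1 k.+1; last first.
    have -> : q.+1 = k.+1 by have := ltn_ord q; lia.
    rewrite Nk mul0mx mxE big1 // => l _; rewrite [X in _ * X]mxE.
    by rewrite (_ : _ == _ = false) ?mulr0 //; have := ltn_ord l; lia.
  rewrite (bigD1 (Ordinal hq)) //= [X in _ + X]big1 => [|l nl].
    by rewrite !mxE /= eqxx mulr1 addr0.
  rewrite [X in _ * X]mxE (_ : _ == _ = false) ?mulr0 //.
  exact: negbTE.
- transitivity ((psi *m N ^+ (k - p).+1) 0 q).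
    by rewrite exprSr -mulmxE mulmxA [RHS]mxE [LHS]mxE; apply: eq_bigr => l _; rewrite !mxE.
  rewrite [RHS]mxE; case: p => -[|p] hp /=.
    rewrite subn0 Nk mulmx0 mxE big1 // => l _.
    by rewrite [X in X * _]mxE mul0r.
  rewrite (bigD1 (Ordinal (ltnW hp))) //= [X in _ + X]big1 => [|l nl].
    rewrite addr0 [X in X * _]mxE [X in _ * X]mxE /= eqxx mul1r.
    by congr ((_ *m N ^+ _) _ _); lia.
  rewrite [X in X * _]mxE /= eqSS eq_sym (_ : _ == _ = false) ?mul0r //.
  exact: negbTE.
Qed.

(** * Complements over a division ring *)

(** Choose [i] with [u i 0] nonzero. Along [u], [S] projects onto the kernel of [w] and [T] onto the
    hyperplane where coordinate [i] is zero; they restrict to inverse isomorphisms between these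
    hyperplanes. [I] and [I'] insert and delete coordinate [i], identifying the second one with
    D^m. *)
Lemma complement1 (D : unitRingType) (n : nat) (u : 'cV[D]_n) (w : 'rV[D]_n) :
  division_ring D -> w *m u = 1%:M ->
  exists m (X : 'M[D]_(n, m)) (Y : 'M[D]_(m, n)), n = m.+1 /\
    [/\ Y *m X = 1%:M, Y *m u = 0, w *m X = 0 & u *m w + X *m Y = 1%:M].
Proof.
move=> hD; case: n u w => [|m] u w wu.
  move/matrixP/(_ 0 0): wu; rewrite !mxE big_ord0 => /eqP.
  by rewrite eq_sym oner_eq0.
have [i ui] : exists i, u i 0 != 0.
  have [/existsP //|/existsPn u0] := boolP [exists i, u i 0 != 0].
  move/matrixP/(_ 0 0): wu; rewrite !mxE big1 => [/eqP|i _].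
    by rewrite eq_sym oner_eq0.
  by have /negPn/eqP -> := u0 i; rewrite mulr0.
pose T : 'M[D]_m.+1 := 1%:M - u *m ((u i 0)^-1)%:M *m delta_mx 0 i.
pose S : 'M[D]_m.+1 := 1%:M - u *m w.
have Tu : T *m u = 0.
  rewrite mulmxBl mul1mx -!mulmxA -rowE (_ : _ *m row i u = 1%:M).
    by rewrite mulmx1 subrr.
  by apply/matrixP => p q; rewrite !ord1 !mxE big_ord1 !mxE eqxx mulr1n mulVr ?hD.
have Su : S *m u = 0 by rewrite mulmxBl mul1mx -mulmxA wu mulmx1 subrr.
have wS : w *m S = 0 by rewrite mulmxBr mulmx1 mulmxA wu mul1mx subrr.
pose I : 'M[D]_(m.+1, m) := col' i 1%:M.
pose I' : 'M[D]_(m, m.+1) := row' i 1%:M.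
have I'E p (X : 'M[D]_(m.+1, p)) : I' *m X = row' i X.
  by rewrite /I' row'Esub mul_rowsub_mx mul1mx.
have dI : delta_mx 0 i *m I = 0 :> 'rV[D]_m.
  by rewrite -rowE; apply/matrixP => p q; rewrite !mxE (negbTE (neq_lift _ _)).
have I'I : I' *m I = 1%:M.
  by rewrite I'E; apply/matrixP => p q; rewrite !mxE (inj_eq lift_inj).
have II' : I *m I' = 1%:M - delta_mx i i.
  apply/matrixP => p q; rewrite [LHS]mxE !mxE.
  have [j ->|->] := unliftP i p.
    rewrite [lift i j == i]eq_sym (negbTE (neq_lift _ _)) subr0 (bigD1 j) //= big1 => [|l nl].
      by rewrite !mxE eqxx mul1r addr0.
    by rewrite !mxE (inj_eq lift_inj) eq_sym (negbTE nl) mul0r.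
  rewrite big1 => [|l _].
    by rewrite eqxx /= eq_sym subrr.
  by rewrite !mxE (negbTE (neq_lift _ _)) mul0r.
have rT : delta_mx 0 i *m T = 0 :> 'rV[D]_m.+1.
  rewrite mulmxBr mulmx1 !mulmxA -rowE (_ : row i u *m _ = 1%:M).
    by rewrite mul1mx subrr.
  by apply/matrixP => p q; rewrite !ord1 !mxE big_ord1 !mxE eqxx mulr1n divrr ?hD.
(* Two projections with the same kernel absorb each other in this way. *)
have TS : T *m S = T by rewrite mulmxBr mulmx1 mulmxA Tu mul0mx subr0.
have ST : S *m T = S by rewrite /T mulmxBr mulmx1 !mulmxA Su !mul0mx subr0.
have dT : delta_mx i i *m T = 0.
  by rewrite -(mul_delta_mx (0 : 'I_1)) -mulmxA rT mulmx0.
exists m, (S *m I), (I' *m T); split=> //; split.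
- rewrite mulmxA -(mulmxA I') TS -mulmxA /T mulmxBl mul1mx -!mulmxA dI.
  by rewrite !mulmx0 subr0.
- by rewrite -mulmxA Tu mulmx0.
- by rewrite mulmxA wS mul0mx.
rewrite mulmxA -(mulmxA S) II' -mulmxA (mulmxBl _ _ T) mul1mx dT subr0 ST.
by rewrite /S addrC subrK.
Qed.

(** Induction on the number of columns: the first column [c] lies in the complement of the others,
    because [L1 *m c = 0], and [complement1] splits it off there. The equation on [n] serves as the
    dimension count. *)
Lemma complement (D : unitRingType) (n k : nat) (C : 'M[D]_(n, k))
    (L : 'M[D]_(k, n)) :
  division_ring D -> L *m C = 1%:M ->
  exists m (C' : 'M[D]_(n, m)) (L' : 'M[D]_(m, n)), n = (k + m)%N /\
    [/\ L' *m C' = 1%:M, L' *m C = 0, L *m C' = 0 & C *m L + C' *m L' = 1%:M].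
Proof.
move=> hD; elim: k C L => [|k IH].
  move=> C L _; exists n, 1%:M, 1%:M; split=> //.
  by rewrite (flatmx0 L) (thinmx0 C) !mulmx0 !mul0mx add0r mulmx1.
rewrite -[k.+1]add1n => C L.
rewrite -[C]hsubmxK -[L]vsubmxK; set l := usubmx L; set L1 := dsubmx L.
set c := lsubmx C; set C1 := rsubmx C.
rewrite mul_col_row (scalar_mx_block 1 k) => /eq_block_mx[lc lC1 L1c L1C1].
have [m [C' [L' [nE [L'C' L'C1 L1C' E1]]]]] := IH _ _ L1C1.
have E2 : C' *m L' = 1%:M - C1 *m L1 by rewrite -E1 addrC addKr.
(* Inside the complement, [c] has coordinates [L' *m c] and [l] restricts to [l *m C']. *)
have Cu : C' *m (L' *m c) = c.
  by rewrite mulmxA E2 mulmxBl mul1mx -mulmxA L1c mulmx0 subr0.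
have wL : l *m C' *m L' = l.
  by rewrite -mulmxA E2 mulmxBr mulmx1 mulmxA lC1 mul0mx subr0.
have wu : (l *m C') *m (L' *m c) = 1%:M by rewrite -mulmxA Cu.
have [m' [X [Y [mE [YX Yu wX E3]]]]] := complement1 hD wu.
exists m', (C' *m X), (Y *m L'); split; first by rewrite nE mE addnS add1n.
split.
- by rewrite mulmxA -(mulmxA Y) L'C' mulmx1.
- by rewrite mul_mx_row -!mulmxA L'C1 Yu mulmx0 row_mx0.
- by rewrite mul_col_mx !mulmxA L1C' wX mul0mx col_mx0.
rewrite mul_row_col mulmxA -(mulmxA C') (_ : X *m Y = 1%:M - L' *m c *m (l *m C')).
  rewrite mulmxBr mulmx1 mulmxBl E2 (mulmxA C' (L' *m c)) Cu -(mulmxA c) wL.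
  by rewrite addrC addrA addrNK addrNK.
by rewrite -E3 addrC addKr.
Qed.

(** * Diagonalizability of direct sums and conjugates *)

Lemma diagonalizable_direct_sum (D : unitRingType) (n k m : nat)
    (C : 'M[D]_(n, k)) (L : 'M[D]_(k, n)) (C' : 'M[D]_(n, m)) (L' : 'M[D]_(m, n))
    (A1 : 'M[D]_k) (A2 : 'M[D]_m) : n = (k + m)%N ->
  L *m C = 1%:M -> L' *m C' = 1%:M -> L' *m C = 0 -> L *m C' = 0 ->
  C *m L + C' *m L' = 1%:M ->
  diagonalizable_mx A1 -> diagonalizable_mx A2 ->
  diagonalizable_mx (C *m A1 *m L + C' *m A2 *m L').
Proof.
move=> nE; subst n => LC LC' L'C LC0 E [B1 dB1 [P1 [Q1 [PQ1 QP1 ->]]]].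
move=> [B2 dB2 [P2 [Q2 [PQ2 QP2 ->]]]].
exists (block_mx B1 0 0 B2); first by rewrite is_diag_block_mx // !eqxx dB1.
(* The two eigenbases are carried into the whole space by [C] and [C']. *)
exists (row_mx (C *m P1) (C' *m P2)), (col_mx (Q1 *m L) (Q2 *m L')); split.
- by rewrite mul_row_col !mulmxA -(mulmxA C) PQ1 -(mulmxA C') PQ2 !mulmx1.
- rewrite mul_col_row (scalar_mx_block k m) !mulmxA.
  rewrite -!(mulmxA _ L) -!(mulmxA _ L') LC LC' L'C LC0.
  by rewrite !mulmx1 !mulmx0 !mul0mx QP1 QP2.
by rewrite mul_row_block !mulmx0 addr0 add0r mul_row_col !mulmxA.
Qed.

Lemma diagonalizable_conj (D : unitRingType) (n : nat) (P Q A : 'M[D]_n) :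
  P *m Q = 1%:M -> Q *m P = 1%:M ->
  diagonalizable_mx A -> diagonalizable_mx (P *m A *m Q).
Proof.
move=> PQ QP [B dB [R [S [RS SR ->]]]]; exists B => //.
exists (P *m R), (S *m Q); split; last by rewrite !mulmxA.
- by rewrite mulmxA -(mulmxA P) RS mulmx1.
- by rewrite mulmxA -(mulmxA S) QP mulmx1.
Qed.

(** * One Jordan block as a product *)

(** The pairing behind [B]. The size is [n.+1] here, so the indices below [n] are reversed among
    themselves and the last index [n] is fixed. *)
Definition rev_fix_max n (j : 'I_n.+1) : 'I_n.+1 :=
  if (j < n)%N then inord (n.-1 - j) else j.

Lemma rev_fix_maxE n (j : 'I_n.+1) :
  rev_fix_max j = (if (j < n)%N then n.-1 - j else j)%N :> nat.
Proof. by rewrite /rev_fix_max; case: ifP => // h; rewrite inordK //; lia. Qed.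

Lemma rev_fix_maxK n : involutive (@rev_fix_max n).
Proof.
move=> j; apply: val_inj; rewrite /= !rev_fix_maxE.
by have jn := ltn_ord j; case: (ltnP j n) => h; case: ifP => h2; lia.
Qed.

(** The product of the two pairings is nilpotent of maximal index [n.+1], so a single chain spans
    the space. Conjugating both factors by that chain turns the product into the Jordan block
    itself. *)
Lemma jordan0_product (D : unitRingType) (c : D) (n : nat) :
  division_ring D -> c != 0 -> c != 1 ->
  exists A B : 'M[D]_n.+1,
    [/\ diagonalizable_mx A, diagonalizable_mx B & jordan0 D n.+1 = A *m B].
Proof.
move=> hD c0 c1.
have Uc : 1 - c \is a GRing.unit by rewrite hD // subr_eq0 eq_sym.
have Cc : c \is a GRing.unit by rewrite hD.
(* The entry 1 + c sits at the larger index of a pair in [A] and at the smaller one in [B]; this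
   keeps the product strictly lower triangular. *)
pose uA (j : 'I_n.+1) := (n < j.*2)%N; pose uB (j : 'I_n.+1) := (j.*2 < n.-1)%N.
(* Of the fixed points, a midpoint gets 1 and the last index gets 0, which makes [B] singular. *)
pose dB (j : 'I_n.+1) : D := if (j < n)%N then 1 else 0.
pose aA j := if rev_ord j == j then 1 else if uA j then 1 + c else 0.
pose bA j := if rev_ord j == j then 0 else if uA j then 1 else - c.
pose aB j := if rev_fix_max j == j then dB j else if uB j then 1 + c else 0.
pose bB j := if rev_fix_max j == j then 0 else if uB j then 1 else - c.
pose A := pair_mx (@rev_ord _) aA bA; pose B := pair_mx (@rev_fix_max _) aB bB.
have diagA : diagonalizable_mx A.
  apply: pair_mx_diagonalizable => //; first exact: rev_ordK.
  by move=> j; rewrite -val_eqE /uA /=; have := ltn_ord j; lia.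
have diagB : diagonalizable_mx B.
  apply: pair_mx_diagonalizable => //; first exact: rev_fix_maxK.
  move=> j; rewrite -val_eqE /uB /= rev_fix_maxE; have jn := ltn_ord j.
  by case: (ltnP j n) => h; lia.
have AB (i j : 'I_n.+1) := @pair_mxM D n.+1 (@rev_ord _) (@rev_fix_max _) aA bA aB bB i j.
have vA (k : 'I_n.+1) : (rev_ord k == k) = (k.*2 == n).
  by rewrite -val_eqE /=; have := ltn_ord k; lia.
have vB (k : 'I_n.+1) : (rev_fix_max k == k) = ((k.*2.+1 == n) || (k == n :> nat)).
  by rewrite -val_eqE /= rev_fix_maxE; have := ltn_ord k; case: (ltnP k n) => h; lia.
have aA0 (k : 'I_n.+1) : (k.*2 < n)%N -> aA k = 0.
  by move=> h; rewrite /aA /uA vA ltn_eqF // ltnNge ltnW.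
have aA1 (k : 'I_n.+1) : k.*2 = n -> aA k = 1.
  by move=> h; rewrite /aA vA h eqxx.
have bA0 (k : 'I_n.+1) : k.*2 = n -> bA k = 0.
  by move=> h; rewrite /bA vA h eqxx.
have bA1 (k : 'I_n.+1) : k.*2 != n -> bA k != 0.
  by rewrite /bA vA => /negbTE ->; case: ifP; rewrite ?oppr_eq0 ?oner_eq0.
have aB0 (k : 'I_n.+1) : (n <= k.*2)%N -> aB k = 0.
  move=> h; rewrite /aB /uB /dB vB; case: ifP => h1; first by case: ifP => // h2; lia.
  by case: ifP => // h2; lia.
have aB1 (k : 'I_n.+1) : k.*2.+1 = n -> aB k = 1.
  by move=> h; rewrite /aB /dB vB h eqxx /=; case: ifP => // h2; lia.
have bB0 (k : 'I_n.+1) : (k.*2.+1 == n) || (k == n :> nat) -> bB k = 0.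
  by move=> h; rewrite /bB vB h.
have bBm (k : 'I_n.+1) : k.*2.+2 = n -> bB k = 1.
  by move=> h; rewrite /bB /uB vB; case: ifP => h1; [lia | case: ifP => //; lia].
have bB1 (k : 'I_n.+1) : k.*2.+1 != n -> (k < n)%N -> bB k != 0.
  move=> h hk; rewrite /bB vB (negbTE h) ltn_eqF //=.
  by case: ifP; rewrite ?oppr_eq0 ?oner_eq0.
(* Column [j] of the product can be nonzero only in rows j, n-j, n-1-j and j+1. If 2j < n, the first
   coefficient vanishes, and so does the third when n-1-j = j. If 2j >= n, only row j+1 can
   survive. *)
have M0 (i j : 'I_n.+1) : (i < j.+1)%N -> (A *m B) i j = 0.
  move=> ij; rewrite AB -!val_eqE /= rev_fix_maxE.
  have jn := ltn_ord j; have [h|h] := ltnP j.*2 n.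
    rewrite aA0 // mul0r mul0rn add0r.
    rewrite (_ : _ == _ = false) ?mulr0n ?add0r; last by lia.
    have [h'|h'] := eqVneq j.*2.+1 n.
      by rewrite bB0 ?h' ?eqxx // !mulr0 !mul0rn addr0.
    rewrite (_ : (j < n)%N); last by lia.
    rewrite [in X in _ + X](_ : _ == _ = false) ?mulr0n ?addr0; last by lia.
    by rewrite (_ : _ == _ = false) ?mulr0n //; lia.
  rewrite aB0 // !mulr0 !mul0rn !add0r.
  have [h'|h'] := ltnP j n; last first.
    by rewrite bB0 ?mulr0 ?mul0rn ?addr0 //; lia.
  rewrite aA0 ?rev_fix_maxE ?h'; last by lia.
  by rewrite mul0r mul0rn add0r (_ : _ == _ = false) ?mulr0n //; lia.
(* The subdiagonal entry is generically [bA (rev_fix_max j) * bB j]. Near the middle other terms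
   supply it: [bA j * aB j] if 2j+1 = n, and [aA (rev_fix_max j) * bB j] if 2j+2 = n. *)
have M1 (i j : 'I_n.+1) : i = j.+1 :> nat -> (A *m B) i j != 0.
  move=> ij; have jn : (j < n)%N by have := ltn_ord i; lia.
  rewrite AB -!val_eqE /= rev_fix_maxE jn.
  rewrite [in X in X + _ + _](_ : _ == _ = false) ?mulr0n ?add0r; last by lia.
  have -> : (i == n.+1 - (n.-1 - j).+1 :> nat)%N by lia.
  have tE : (rev_fix_max j = n.-1 - j :> nat)%N by rewrite rev_fix_maxE jn.
  have [h|h] := eqVneq j.*2.+1 n.
    rewrite aB1 // bB0 ?h ?eqxx // !mulr0 !mul0rn !addr0 mulr1.
    have -> : (i == n.+1 - j.+1 :> nat)%N by lia.
    by rewrite mulr1n bA1 //; lia.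
  rewrite (_ : _ == (n.+1 - j.+1)%N = false) ?mulr0n ?add0r; last by lia.
  have [h'|h'] := eqVneq j.*2.+2 n.
    have -> : (i == n.-1 - j :> nat)%N by lia.
    rewrite bA0 ?tE; last by lia.
    rewrite aA1 ?tE; last by lia.
    by rewrite bBm // mul0r mul0rn addr0 mulr1 oner_eq0.
  rewrite (_ : _ == (n.-1 - j)%N = false) ?mulr0n ?add0r; last by lia.
  rewrite mulr1n; apply/eqP => E.
  have /eqP[] : bA (rev_fix_max j) != 0 by apply: bA1; rewrite tE; lia.
  by apply: (mulIr (hD _ (bB1 j h jn))); rewrite mul0r.
have pow := subdiag_expr hD M0 M1.
have pow0 : (A *m B) ^+ n.+1 = 0.
  apply/matrixP => i j; rewrite (pow n.+1).1 ?mxE //.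
  by have := ltn_ord i; lia.
have pow1 : (A *m B) ^+ n != 0.
  apply/eqP => /matrixP/(_ ord_max 0)/eqP; apply/negP.
  by rewrite [X in _ == X]mxE; apply: (pow n).2.
have [C [L [LC NC LN]]] := nilpotent_chain hD pow0 pow1.
(* By dimension the complement is zero, so [L] is a two-sided inverse of [C]. *)
have [m [C' [L' [mE [_ _ _ E]]]]] := complement hD LC.
have m0 : m = 0%N by lia.
subst m; rewrite (flatmx0 L') mulmx0 addr0 in E.
exists (L *m A *m C), (L *m B *m C); split; try exact: diagonalizable_conj.
rewrite !mulmxA -(mulmxA _ C) E mulmx1 -(mulmxA _ A) -mulmxA NC mulmxA LC.
by rewrite mul1mx.
Qed.

(** * A scalar other than 0 and 1 *)

(** If 0 and 1 were the only elements, then 1 + 1 = 0 and the indicator of being nonzero would be an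
    isomorphism onto ['F_2]. *)
Lemma third_element (D : unitRingType) : division_ring D -> ~ is_field_of_two D ->
  exists2 c : D, c != 0 & c != 1.
Proof.
move=> hD D2; apply: Classical_Prop.NNPP => noc; apply: D2.
have D01 (x : D) : x = 0 \/ x = 1.
  have [->|x0] := eqVneq x 0; first by left.
  have [->|x1] := eqVneq x 1; first by right.
  by case: noc; exists x.
have D11 : 1 + 1 = 0 :> D.
  case: (D01 (1 + 1)) => // /eqP.
  by rewrite -subr_eq0 addrK oner_eq0.
have N1 : - 1 = 1 :> D by apply/eqP; rewrite eq_sym -addr_eq0 D11.
pose f (x : D) : 'F_2 := (x != 0)%:R.
have fA : zmod_morphism f.
  move=> x y; rewrite /f; case: (D01 x) => ->; case: (D01 y) => ->;
    rewrite ?subr0 ?sub0r ?subrr ?N1 ?eqxx ?oner_eq0 //=; exact: val_inj.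
have fM : monoid_morphism f.
  split=> [|x y]; rewrite /f ?oner_eq0 //.
  by case: (D01 x) => ->; rewrite ?mul0r ?mul1r ?eqxx ?oner_eq0 /= ?mul0r ?mul1r.
pose fa := GRing.isZmodMorphism.Build _ _ f fA.
pose fm := GRing.isMonoidMorphism.Build _ _ f fM.
pose F : {rmorphism D -> 'F_2} := HB.pack f fa fm.
exists F; exists (fun y : 'F_2 => if y == 0 then 0 else 1 : D).
  move=> x; rewrite /= /f; case: (D01 x) => ->; first by rewrite eqxx.
  by rewrite oner_eq0.
move=> y; rewrite /= /f; case: (eqVneq y 0) => [->|]; first by rewrite eqxx.
rewrite oner_eq0 /=; case: y => -[|[|//]] hy ny; apply: val_inj => //=.
Qed.

(** * Arbitrary nilpotent matrices *)

(** Strong induction on the size: a Jordan block of the largest size [k.+1] is split off, and the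
    rest is smaller. *)
Lemma nilpotent_product (D : unitRingType) (c : D) (n : nat) (N : 'M[D]_n) :
  division_ring D -> c != 0 -> c != 1 -> nilpotent_mx N ->
  exists A B : 'M[D]_n,
    [/\ diagonalizable_mx A, diagonalizable_mx B & N = A *m B].
Proof.
move=> hD c0 c1; elim/ltn_ind: n N => n IH N [t Nt].
have [t0 t0P tmin] := ex_minnP (ex_intro (fun t => N ^+ t == 0) t (introT eqP Nt)).
(* Index 0 means 1 = 0, which is the empty matrix. *)
case: t0 t0P tmin => [/eqP N0 _|k /eqP Nk kmin].
  have E1 : 1%:M = 0 :> 'M[D]_n by rewrite -N0 expr0.
  have dN : diagonalizable_mx N.
    exists N; first by rewrite -[N]mulmx1 E1 mulmx0; apply/is_diag_mxP => i j; rewrite mxE.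
    by exists 1%:M, 1%:M; rewrite !mulmx1 mul1mx.
  by exists N, N; rewrite -[N]mulmx1 E1 !mulmx0; rewrite -[N]mulmx1 E1 mulmx0 in dN.
have Nk' : N ^+ k != 0 by apply/negP => /kmin; rewrite ltnn.
have [C [L [LC NC LN]]] := nilpotent_chain hD Nk Nk'.
have [m [C' [L' [nE [L'C' L'C LC' E]]]]] := complement hD LC.
pose N' := L' *m N *m C'.
(* The complement is [N]-stable because [L *m N *m C'] equals [jordan0 D k.+1 *m L *m C'], which is
   0. *)
have NC' : N *m C' = C' *m N'.
  rewrite /N' !mulmxA -[LHS]mul1mx -E mulmxDl -!mulmxA (mulmxA L) LN.
  by rewrite -mulmxA LC' !mulmx0 add0r.
have nilN' : nilpotent_mx N'.
  exists t; have H s : N ^+ s *m C' = C' *m N' ^+ s.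
    elim: s => [|s IHs]; first by rewrite !expr0 mul1mx mulmx1.
    by rewrite !exprS -!mulmxE -mulmxA IHs mulmxA NC' -mulmxA.
  by rewrite -[LHS]mul1mx -L'C' -mulmxA -H Nt mul0mx mulmx0.
have [A1 [B1 [dA1 dB1 J1]]] := jordan0_product k hD c0 c1.
have [|A2 [B2 [dA2 dB2 J2]]] := IH m _ N' nilN'; first by lia.
exists (C *m A1 *m L + C' *m A2 *m L'), (C *m B1 *m L + C' *m B2 *m L').
split; try exact: diagonalizable_direct_sum.
rewrite mulmxDl !mulmxDr !mulmxA -!(mulmxA _ L) -!(mulmxA _ L') LC L'C' L'C LC'.
rewrite !mulmx0 !mul0mx !mulmx1 addr0 add0r -(mulmxA C) -J1 -(mulmxA C') -J2.
by rewrite -NC -NC' -!mulmxA -mulmxDr E mulmx1.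
Qed.

(** * Sharpness of the number 2 *)

(** A diagonal matrix of square zero over a division ring is zero, and only the zero matrix is
    similar to it. *)
Lemma nilpotent_not_diagonalizable (D : unitRingType) :
  division_ring D ->
  let N : 'M[D]_2 := delta_mx 0 1 in nilpotent_mx N /\ ~ diagonalizable_mx N.
Proof.
move=> hD N; have N2 : N *m N = 0 by rewrite /N mul_delta_mx_0.
split; first by exists 2%N; rewrite expr2 -mulmxE.
move=> [B /is_diag_mxP dB [P [Q [PQ QP E]]]].
have B2 : B *m B = 0.
  transitivity (Q *m (N *m N) *m P); last by rewrite N2 mulmx0 mul0mx.
  rewrite E !mulmxA QP mul1mx -(mulmxA _ Q P) QP mulmx1 -(mulmxA _ Q P) QP.
  by rewrite mulmx1.
have B0 : B = 0.
  apply/matrixP => i j; rewrite mxE; have [<-|nij] := eqVneq i j; last exact: dB.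
  move/matrixP/(_ i i): B2; rewrite !mxE (bigD1 i) //= big1 => [|l nl].
    rewrite addr0 => Bii; have [//|nB] := eqVneq (B i i) 0.
    by apply: (mulrI (hD _ nB)); rewrite mulr0.
  by rewrite dB ?mul0r // eq_sym.
move/matrixP/(_ 0 1): E; rewrite B0 mulmx0 mul0mx !mxE !eqxx => /eqP.
by rewrite oner_eq0.
Qed.

Theorem theorem3p3 :
  (forall D : unitRingType, division_ring D -> ~ is_field_of_two D ->
   forall n : nat, (0 < n)%N ->
   forall N : 'M[D]_n, nilpotent_mx N ->
   exists A B : 'M[D]_n,
     [/\ diagonalizable_mx A, diagonalizable_mx B & N = A *m B])
  /\
  (exists D : unitRingType,
     [/\ division_ring D, ~ is_field_of_two D &
      exists n : nat, (0 < n)%N /\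
      exists N : 'M[D]_n, nilpotent_mx N /\ ~ diagonalizable_mx N]).
Proof.
split=> [D hD D2 n _ N nilN|].
  have [c c0 c1] := third_element hD D2.
  exact: nilpotent_product hD c0 c1 nilN.
have hQ : division_ring rat by move=> x; rewrite unitfE.
exists rat; split=> //.
  (* A morphism to ['F_2] identifies 2 with 0, which are distinct rationals. *)
  move=> [f bf]; have : f 2%:R = f 0 by rewrite rmorph_nat rmorph0; apply: val_inj.
  by move/(bij_inj bf).
by exists 2%N; split=> //; exists (delta_mx 0 1); apply: nilpotent_not_diagonalizable.
Qed.
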